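(* Let $K$ be an infinite field and let $\mathcal O$ be the local ring of a plane algebroid curve over $K$ with $d$ branches, with maximal ideal generated by $x,y$, written as $$\mathcal O=K[[x]]+K[[x]]y+\cdots+K[[x]]y^{N-1},$$ where $v(x)=(e_1,\dots,e_d)=\min(v(\mathcal O)\setminus\{\mathbf 0\})$ and $N=e_1+\cdots+e_d$ is the multiplicity of $\mathcal O$. Let $\mathcal B(\mathcal O)$ be the blow-up of $\mathcal O$, and suppose it is semilocal. Then, for an opportune choice of $G\in\mathcal B(\mathcal O)$ such that $$\mathcal B(\mathcal O)=K[[x]]+K[[x]]G+\cdots+K[[x]]G^{N-1},$$ the ring $$\mathcal U=K[[x]]+K[[x]]\,xG+\cdots+K[[x]]\,x^{N-1}G^{N-1}$$ is equal to $\mathcal O$.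
   Context: A plane algebroid curve over $K$ is a ring $\mathcal O=K[[X,Y]]/(H_1\cdots H_d)$ with $H_1,\dots,H_d$ irreducible and pairwise coprime; its branches are the rings $K[[X,Y]]/(H_i)$. The integral closure of each branch is a power series ring $K[[t_i]]$, so the integral closure of $\mathcal O$ in its total ring of fractions is $K[[t_1]]\times\cdots\times K[[t_d]]$; the local factors of $\mathcal B(\mathcal O)$ have residue field $K$. For a non-zero-divisor $g$, $v(g)\in\mathbb N^d$ is the vector of orders in $t_1,\dots,t_d$; $v(\mathcal O)$ is the set of values of the non-zero-divisors of $\mathcal O$; the minimum is with respect to the componentwise order. The blow-up of $(\mathcal O,\mathfrak m)$ is $\mathcal B(\mathcal O)=\bigcup_n(\mathfrak m^n:\mathfrak m^n)$ inside the total ring of fractions; if $\mathfrak m=(x,y)$ and $v(x)$ is the minimal value of elements of $\mathfrak m$, then $\mathcal B(\mathcal O)=\mathcal O[y/x]$. *)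

(* Defs.v *)
From HB Require Import structures.
From mathcomp Require Import all_boot all_order all_algebra.
From mathcomp Require Import boolp classical_sets functions cardinality.

Set Implicit Arguments.
Unset Strict Implicit.
Unset Printing Implicit Defensive.

Import GRing.Theory.

Local Open Scope classical_set_scope.
Local Open Scope ring_scope.

(** * Formal power series *)

(* A wrapper around [nat -> R], so that multiplication is the Cauchy product
   and not the pointwise product carried by function types. *)
Record fps (R : Type) := Fps { coefs : nat -> R }.

Notation "{ 'fps' R }" := (fps R) (at level 0, format "{ 'fps'  R }").

Lemma fpsP (R : Type) (f g : {fps R}) : coefs f =1 coefs g -> f = g.
Proof. by case: f g => [f] [g] /= /funext ->. Qed.

HB.instance Definition _ (R : Type) := gen_eqMixin {fps R}.
HB.instance Definition _ (R : Type) := gen_choiceMixin {fps R}.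

Section FpsRing.
Variable R : comNzRingType.
Implicit Types f g h : {fps R}.

Definition fps_zero : {fps R} := Fps (fun _ => 0).
Definition fps_opp f : {fps R} := Fps (fun n => - coefs f n).
Definition fps_add f g : {fps R} := Fps (fun n => coefs f n + coefs g n).

Definition fpsC (c : R) : {fps R} := Fps (fun n => if n == 0%N then c else 0).

Definition fps_mul f g : {fps R} :=
  Fps (fun n => \sum_(i < n.+1) coefs f i * coefs g (n - i)).

Fact fps_addA : associative fps_add.
Proof. by move=> f g h; apply: fpsP => n /=; rewrite addrA. Qed.
Fact fps_addC : commutative fps_add.
Proof. by move=> f g; apply: fpsP => n /=; rewrite addrC. Qed.
Fact fps_add0 : left_id fps_zero fps_add.
Proof. by move=> f; apply: fpsP => n /=; rewrite add0r. Qed.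
Fact fps_addN : left_inverse fps_zero fps_opp fps_add.
Proof. by move=> f; apply: fpsP => n /=; rewrite addNr. Qed.

HB.instance Definition _ :=
  GRing.isZmodule.Build {fps R} fps_addA fps_addC fps_add0 fps_addN.

Definition fps_trunc m f : {poly R} := \poly_(i < m) coefs f i.

Lemma coef_fps_mul m n f g : (n < m)%N ->
  coefs (fps_mul f g) n = (fps_trunc m f * fps_trunc m g)`_n.
Proof.
move=> nm; rewrite coefM /=; apply: eq_bigr => i _.
rewrite !coef_poly (leq_ltn_trans _ nm) ?(leq_ltn_trans (leq_subr _ _) nm) //.
by rewrite -ltnS.
Qed.

Lemma coef_trunc_mull m n f g (p : {poly R}) : (n < m)%N ->
  (fps_trunc m (fps_mul f g) * p)`_n = (fps_trunc m f * fps_trunc m g * p)`_n.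
Proof.
move=> nm; rewrite !coefM; apply: eq_bigr => i _; congr (_ * _).
have im : (i < m)%N by rewrite (leq_ltn_trans _ nm) // -ltnS.
by rewrite coef_poly im (coef_fps_mul _ _ im).
Qed.

Fact fps_mulC : commutative fps_mul.
Proof.
by move=> f g; apply: fpsP => n; rewrite !(coef_fps_mul _ _ (ltnSn n)) mulrC.
Qed.

Fact fps_mulA : associative fps_mul.
Proof.
move=> f g h; apply: fpsP => n; have nn := ltnSn n.
rewrite [fps_mul f (fps_mul g h)]fps_mulC !(coef_fps_mul _ _ nn).
by rewrite !coef_trunc_mull //; congr (_`__); rewrite mulrC mulrA.
Qed.

Fact fps_mul1 : left_id (fpsC 1) fps_mul.
Proof.
move=> f; apply: fpsP => n /=; rewrite big_ord_recl /= mul1r subn0.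
by rewrite big1 ?addr0 // => i _; rewrite mul0r.
Qed.

Fact fps_mulDl : left_distributive fps_mul fps_add.
Proof.
move=> f g h; apply: fpsP => n /=; rewrite -big_split /=.
by apply: eq_bigr => i _; rewrite mulrDl.
Qed.

Fact fps_oner_neq0 : fpsC 1 != 0.
Proof.
by apply/eqP => /(congr1 (fun f => coefs f 0)) /= /eqP; rewrite oner_eq0.
Qed.

HB.instance Definition _ := GRing.Zmodule_isComNzRing.Build {fps R}
  fps_mulA fps_mulC fps_mul1 fps_mulDl fps_oner_neq0.

Definition fps_unit : {pred {fps R}} := fun f => `[< exists g, g * f = 1 >].

Definition fps_inv f : {fps R} :=
  if pselect (exists g, g * f = 1) is left ex then projT1 (cid ex) else f.

Fact fps_mulVr : {in fps_unit, left_inverse 1 fps_inv *%R}.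
Proof.
move=> f /asboolP fU; rewrite /fps_inv.
by case: pselect => // ex; case: cid.
Qed.
Fact fps_unitP f g : g * f = 1 -> fps_unit f.
Proof. by move=> gf; apply/asboolP; exists g. Qed.
Fact fps_inv_out : {in [predC fps_unit], fps_inv =1 id}.
Proof.
move=> f; rewrite inE => /asboolP fU; rewrite /fps_inv.
by case: pselect.
Qed.

HB.instance Definition _ := GRing.ComNzRing_hasMulInverse.Build {fps R}
  fps_mulVr fps_unitP fps_inv_out.

(* The order in the variable; the value at [f = 0] is a dummy. *)
Definition fps_order f : nat :=
  if pselect (exists n, coefs f n != 0) is left ex then ex_minn ex else 0%N.

Lemma fps_orderP f : f != 0 ->
  coefs f (fps_order f) != 0 /\
  (forall k, (k < fps_order f)%N -> coefs f k = 0).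
Proof.
move=> f0; rewrite /fps_order; case: pselect => [ex|nex].
  case: ex_minnP => n fn nmin; split => // k kn; apply/eqP.
  by apply: contraTT kn => /nmin; rewrite leqNgt.
case/eqP: f0; apply: fpsP => n /=; apply/eqP.
by apply: contra_notT nex => fn; exists n.
Qed.

End FpsRing.

Section FpsDomain.
Variable R : idomainType.

Fact fps_mulf_eq0 (f g : {fps R}) : f * g = 0 -> (f == 0) || (g == 0).
Proof.
move=> fg; apply: contraPT fg; rewrite negb_or => /andP[f0 g0].
have [fa fl] := fps_orderP f0; have [gb gl] := fps_orderP g0.
move: (fps_order f) (fps_order g) fa fl gb gl => a b fa fl gb gl.
move=> /(congr1 (fun f => coefs f (a + b)%N)) /=.
have ab : (a < (a + b).+1)%N by rewrite ltnS leq_addr.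
rewrite (bigD1 (Ordinal ab)) //= addKn big1 ?addr0.
  by apply/eqP; rewrite mulf_neq0.
move=> i; rewrite -val_eqE /= => ia.
have [lt_ia|] := ltnP i a; first by rewrite fl // mul0r.
rewrite leq_eqVlt eq_sym (negPf ia) /= => lt_ai.
rewrite [X in _ * X]gl ?mulr0 // ltn_subLR ?ltn_add2r // -ltnS.
exact: ltn_ord.
Qed.

HB.instance Definition _ :=
  GRing.ComUnitRing_isIntegral.Build {fps R} fps_mulf_eq0.
End FpsDomain.

(** * Ideals and subrings *)

Section Divisibility.
Variable A : comUnitRingType.
Implicit Types a b c : A.

Definition divides a b := exists c, b = c * a.

Definition irreducible a :=
  [/\ a != 0, a \isn't a GRing.unit &
      forall b c, a = b * c -> b \is a GRing.unit \/ c \is a GRing.unit].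

Definition coprime_elts a b :=
  forall c, divides c a -> divides c b -> c \is a GRing.unit.

(* The maximal ideal of [A], for [A] local. *)
Definition nonunits : set A := [set a | a \isn't a GRing.unit].
End Divisibility.
Arguments nonunits : clear implicits.

Section Ideals.
Variable A : comNzRingType.
Implicit Types I J B M : set A.

Definition ideal_gen2 (x y : A) : set A :=
  [set z | exists a b, z = a * x + b * y].

Definition ideal_mul I J : set A :=
  [set z | exists k (a b : 'I_k -> A),
     [/\ forall i, I (a i), forall i, J (b i) & z = \sum_i a i * b i]].

Fixpoint ideal_exp I n : set A :=
  if n is n'.+1 then ideal_mul I (ideal_exp I n') else setT.

Definition colon I J : set A := [set z | forall b, J b -> I (z * b)].

(* B w_0 + ... + B w_(N-1). *)
Definition module_span B N (w : nat -> A) : set A :=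
  [set z | exists c : 'I_N -> A,
     (forall i, B (c i)) /\ z = \sum_(i < N) c i * w i].

(* Ideals of a subring [B] of [A]. *)
Definition ideal_of B M :=
  [/\ M `<=` B, M 0, forall a b, M a -> M b -> M (a + b) &
      forall b a, B b -> M a -> M (b * a)].

Definition maximal_ideal_of B M :=
  [/\ ideal_of B M, M <> B &
      forall M', ideal_of B M' -> M `<=` M' -> M' = M \/ M' = B].

Definition semilocal B := finite_set [set M | maximal_ideal_of B M].
End Ideals.

(* [L], together with [iota], is the total ring of fractions of [A];
   [GRing.lreg s] says that [s] is not a zero divisor. *)
Definition total_fraction_ring (A : comNzRingType) (L : comUnitRingType)
    (iota : A -> L) :=
  [/\ injective iota,
      forall s, GRing.lreg s -> iota s \is a GRing.unit &
      forall z, exists a s, GRing.lreg s /\ z = iota a / iota s].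

(** * Plane algebroid curves *)

Section Curve.
Variable K : fieldType.

(* K[[X,Y]], as K[[X]][[Y]]. *)
Notation KXY := {fps {fps K}}.

Definition constXY (c : K) : KXY := fpsC (fpsC c).

(* [pi] identifies [O] with K[[X,Y]]/(H_1 ... H_d). *)
Definition plane_algebroid_curve (d : nat) (H : 'I_d -> KXY)
    (O : comUnitRingType) (pi : KXY -> O) :=
  [/\ (0 < d)%N,
      forall i, irreducible (H i),
      forall i j, i != j -> coprime_elts (H i) (H j),
      forall z, exists a, pi a = z &
      forall a, pi a = 0 <-> divides (\prod_i H i) a].

(* [phi] is a morphism of K-algebras inducing an embedding of the branch
   K[[X,Y]]/(h) into K[[t]], such that K((t)) is the field of fractions of the
   branch and K[[t]] is the integral closure of the branch in K((t)). *)
Definition branch_normalization (h : KXY) (phi : KXY -> {fps K}) :=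
  [/\ forall c, phi (constXY c) = fpsC c,
      forall a, phi a = 0 <-> divides h a,
      forall z : {fraction {fps K}}, exists a s,
        phi s != 0 /\ z = tofrac (phi a) / tofrac (phi s) &
      forall z : {fraction {fps K}},
        integralOver (fun a => tofrac (phi a)) z <->
        exists u, z = tofrac u].

Section Values.
Variables (O : comUnitRingType) (d : nat) (nu : 'I_d -> O -> {fps K}).

(* The vector of the orders in t_1, ..., t_d; it is meaningful only if [g] is
   not a zero divisor. *)
Definition value (g : O) : 'I_d -> nat := fun i => fps_order (nu i g).

Definition value_set : set ('I_d -> nat) :=
  [set value g | g in [set g | GRing.lreg g]].
End Values.

Definition is_minimum (d : nat) (S : set ('I_d -> nat)) (e : 'I_d -> nat) :=
  S e /\ forall a, S a -> forall i, (e i <= a i)%N.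

(* K[[x]] for [x] in the maximal ideal of [O]: the sums, in the topology defined
   by the powers of the maximal ideal, of the series \sum_j c_j x^j. *)
Definition power_series_in (O : comUnitRingType) (pi : KXY -> O) (x : O) :
    set O :=
  [set z | exists f : {fps K}, forall n,
     ideal_exp (nonunits O)
       n (z - \sum_(j < n) pi (constXY (coefs f j)) * x ^+ j)].

Definition blowup (O L : comUnitRingType) (iota : O -> L) : set L :=
  \bigcup_n colon (iota @` ideal_exp (nonunits O) n)
                  (iota @` ideal_exp (nonunits O) n).

(* The elements of K represent all the residue classes of the subring [B]
   modulo each of its maximal ideals. *)
Definition residue_fields_are_K (L : comUnitRingType) (k : K -> L)
    (B : set L) :=
  forall M, maximal_ideal_of B M ->
  forall b, B b -> exists c, M (b - k c).
End Curve.

(* Main.v *)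
(* Take G = y/x, so that x^i G^i = y^i and U = O by assumption.  What is left
   is B(O) = K[[x]][G] = K[[x]] + ... + K[[x]] G^(N-1), for which it suffices
   that G is a root of a monic polynomial of degree N over K[[x]].  On the i-th
   branch, K[[t_i]] is generated by 1, ..., t_i^(e_i - 1) as a module over
   K[[x]], and y/x lies in K[[t_i]] because v(x) is minimal; hence, by
   Cayley-Hamilton, y/x is a root of a monic polynomial of degree e_i over
   K[[x]].  The product of these polynomials has degree N and kills G on all
   the branches, hence in the total ring of fractions of O. *)

Require Import Defs.
From HB Require Import structures.
From mathcomp Require Import all_boot all_order all_algebra.
From mathcomp Require Import boolp classical_sets functions cardinality.
From mathcomp Require Import zify ring.

Set Implicit Arguments.
Unset Strict Implicit.
Unset Printing Implicit Defensive.

Import GRing.Theory.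

Local Open Scope classical_set_scope.
Local Open Scope ring_scope.

(** * Power series: coefficients, order of vanishing, units *)

Section Fps.
Variable R : comNzRingType.
Implicit Types f g h : {fps R}.

Lemma coefs_sum I (r : seq I) (P : pred I) (F : I -> {fps R}) n :
  coefs (\sum_(i <- r | P i) F i) n = \sum_(i <- r | P i) coefs (F i) n.
Proof. by apply: (big_morph (fun f => coefs f n)). Qed.

Lemma coefsD f g n : coefs (f + g) n = coefs f n + coefs g n.
Proof. by []. Qed.

Lemma coefsB f g n : coefs (f - g) n = coefs f n - coefs g n.
Proof. by []. Qed.

Lemma coefs1 n : coefs (1 : {fps R}) n = (n == 0)%N%:R.
Proof. by case: n. Qed.

Lemma coefsCM (c : R) f n : coefs (fpsC c * f) n = c * coefs f n.
Proof. by rewrite /= big_ord_recl subn0 big1 ?addr0 // => i _; rewrite mul0r. Qed.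

Lemma coefs0M f g : coefs (f * g) 0 = coefs f 0 * coefs g 0.
Proof. by rewrite /= big_ord1. Qed.

Lemma fpsC_is_zmod_morphism : zmod_morphism (@fpsC R).
Proof. by move=> a b; apply: fpsP => -[|n] //=; rewrite subr0. Qed.

Lemma fpsC_is_monoid_morphism : monoid_morphism (@fpsC R).
Proof.
by split=> // a b; apply: fpsP => -[|n]; rewrite coefsCM //= mulr0.
Qed.

HB.instance Definition _ :=
  GRing.isZmodMorphism.Build R {fps R} (@fpsC R) fpsC_is_zmod_morphism.
HB.instance Definition _ :=
  GRing.isMonoidMorphism.Build R {fps R} (@fpsC R) fpsC_is_monoid_morphism.

Definition fpsX : {fps R} := Fps (fun n => (n == 1)%N%:R).

Definition fps_shift f : {fps R} := Fps (fun n => coefs f n.+1).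

Lemma coefsXM f n : coefs (fpsX * f) n = if n is m.+1 then coefs f m else 0.
Proof.
case: n => [|n]; first by rewrite coefs0M mul0r.
rewrite /= 2!big_ord_recl mul0r add0r mul1r /= subSS subn0 big1 ?addr0 //.
by move=> i _; rewrite mul0r.
Qed.

Lemma fps_shiftE f : f = fpsC (coefs f 0) + fpsX * fps_shift f.
Proof.
by apply: fpsP => -[|n]; rewrite coefsD coefsXM /= ?addr0 ?add0r.
Qed.

(** This is the ideal generated by the n-th power of the variable; identities between series are
    checked modulo each of these ideals. *)
Definition vanish n : set {fps R} := [set f | forall k, (k < n)%N -> coefs f k = 0].

Lemma vanishD n f g : vanish n f -> vanish n g -> vanish n (f + g).
Proof. by move=> vf vg k kn /=; rewrite vf // vg // addr0. Qed.

Lemma vanishM m n f g : vanish m f -> vanish n g -> vanish (m + n) (f * g).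
Proof.
move=> vf vg k kmn /=; rewrite big1 // => i _.
have [im|mi] := ltnP i m; first by rewrite vf // mul0r.
rewrite [X in _ * X]vg ?mulr0 // ltn_subLR; last by rewrite -ltnS.
by rewrite (leq_trans kmn) // leq_add2r.
Qed.

Lemma vanishX n f : coefs f 0 = 0 -> vanish n (f ^+ n).
Proof.
move=> f0; elim: n => [|n IHn]; first by [].
by rewrite exprS -add1n; apply: vanishM => // -[].
Qed.

Lemma vanishW m n f : (m <= n)%N -> vanish n f -> vanish m f.
Proof. by move=> mn vf k km; apply: vf; apply: leq_trans mn. Qed.

Lemma vanishMr n f g : vanish n g -> vanish n (f * g).
Proof. by move=> vg; rewrite -[n]add0n; apply: vanishM. Qed.

Lemma vanish_sum n I (r : seq I) (P : pred I) (F : I -> {fps R}) :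
  (forall i, P i -> vanish n (F i)) -> vanish n (\sum_(i <- r | P i) F i).
Proof.
by move=> vF; apply: (big_ind (vanish n)) => //; apply: vanishD.
Qed.

Lemma vanish_eq0 f : (forall n, vanish n f) -> f = 0.
Proof. by move=> vf; apply: fpsP => n; apply: (vf n.+1). Qed.

Lemma vanish_factor n f : vanish n f -> exists h, f = fpsX ^+ n * h.
Proof.
elim: n f => [|n IHn] f vf; first by exists f; rewrite mul1r.
have [|h fh] := IHn (fps_shift f); first by move=> k kn; apply: vf.
by exists h; rewrite exprS -mulrA -fh {1}[f]fps_shiftE vf // rmorph0 add0r.
Qed.

(** The inverse is the geometric series of [f]. As f^j vanishes to order j, the coefficient of
    degree n is already that of the partial sum of n+1 terms. *)
Lemma fps_sub1_unit f : coefs f 0 = 0 -> 1 - f \is a GRing.unit.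
Proof.
move=> f0; pose s n := \sum_(j < n) f ^+ j.
pose g : {fps R} := Fps (fun n => coefs (s n.+1) n).
have gs n k : (k < n)%N -> coefs g k = coefs (s n) k.
  elim: n => // n IHn; rewrite ltnS leq_eqVlt => /orP[/eqP->//|kn].
  by rewrite IHn // /s big_ord_recr /= vanishX // addr0.
apply/unitrPr; exists g; apply: fpsP => n.
transitivity (coefs ((1 - f) * s n.+1) n).
  by apply: eq_bigr => i _; rewrite (gs n.+1) // ltnS leq_subr.
rewrite -opprB mulNr -subrX1 opprB coefsB.
by rewrite (@vanishX n.+1) // subr0.
Qed.

End Fps.

Arguments fpsX {R}.

(** Scaling by the inverse of the constant term reduces the converse to the geometric series. *)
Lemma fps_unitE (R : comUnitRingType) (f : {fps R}) :
  (f \is a GRing.unit) = (coefs f 0 \is a GRing.unit).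
Proof.
apply/idP/idP => [/unitrPr[g fg]|f0U].
  by apply/unitrPr; exists (coefs g 0); rewrite -coefs0M fg.
pose c : {fps R} := fpsC (coefs f 0)^-1.
have := @fps_sub1_unit _ (1 - c * f); rewrite subKr unitrM => /(_ _)/andP[] //.
by rewrite /= big_ord1 /= mulVr ?subrr.
Qed.

Lemma coefsXnM (R : comNzRingType) (f : {fps R}) n k :
  coefs (fpsX ^+ n * f) (n + k) = coefs f k.
Proof.
by elim: n => [|n IHn]; rewrite ?mul1r // exprS -mulrA addSn coefsXM.
Qed.

Lemma coefsXn (R : comNzRingType) n k : coefs (fpsX ^+ n : {fps R}) k = (k == n)%:R.
Proof.
elim: n k => [|n IHn] k; first exact: coefs1.
by rewrite exprS coefsXM; case: k => [|k] //; rewrite IHn eqSS.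
Qed.

(** Determinant trick: multiplication by [a] acts on the generators [w] through a matrix [M] over
    [R], so det(a - M) kills every generator, in particular 1. The annihilator is the characteristic
    polynomial of [M]. *)
Lemma monic_annihilator (R A : comNzRingType) (phi : {rmorphism R -> A})
    n (w : 'I_n -> A) i0 :
  w i0 = 1 -> (forall a, exists q, a = \sum_i phi (q i) * w i) ->
  forall a, exists g,
    [/\ g \is monic, size g = n.+1 & (map_poly phi g).[a] = 0].
Proof.
move=> w1 wspan a; have [q qE] := choice (fun i => wspan (a * w i)).
pose M : 'M_n := \matrix_(i, k) q i k.
exists (char_poly M); rewrite char_poly_monic size_char_poly; split=> //.
pose B := a%:M - map_mx phi M.
have -> : (map_poly phi (char_poly M)).[a] = \det B.
  rewrite map_char_poly -[_.[a]]/(horner_eval a _) -det_map_mx.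
  by congr (\det _); apply/matrixP => i k; rewrite !mxE /= /horner_eval !hornerE
    hornerMn hornerX.
have BW : B *m (\col_i w i) = 0.
  apply/matrixP => i j; rewrite mulmxBl mul_scalar_mx !mxE qE; apply/eqP.
  by rewrite subr_eq0; apply/eqP/eq_bigr => k _; rewrite !mxE.
have /matrixP/(_ i0 0) : (\det B)%:M *m (\col_i w i) = 0.
  by rewrite -mul_adj_mx -mulmxA BW mulmx0.
by rewrite mul_scalar_mx !mxE w1 mulr1.
Qed.

(** * Division of power series over a field *)

Section FieldSeries.
Variable K : fieldType.
Implicit Types u f : {fps K}.

(** Over a field, a nonzero [u] is a power of the variable times a unit. *)
Lemma fps_dvd u f : u != 0 -> vanish (fps_order u) f -> exists g, f = u * g.
Proof.
move=> u0 vf; have [ue uv] := fps_orderP u0.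
have [v uE] := vanish_factor uv; have [h fE] := vanish_factor vf.
have vU : v \is a GRing.unit.
  by rewrite fps_unitE -(coefsXnM v (fps_order u)) -uE addn0 unitfE.
by exists (v^-1 * h); rewrite {1}uE -mulrA mulVKr.
Qed.

(** Here [phi] substitutes [u] for the variable. Repeated division by [u] gives remainders of degree
    below the order of [u], the digits of an expansion of [f] in powers of [u]. *)
Lemma fps_division u (phi : {rmorphism {fps K} -> {fps K}}) :
  u != 0 -> coefs u 0 = 0 ->
  (forall f n, vanish n (phi f - \sum_(j < n) fpsC (coefs f j) * u ^+ j)) ->
  forall f, exists q : 'I_(fps_order u) -> {fps K},
    f = \sum_i phi (q i) * fpsX ^+ i.
Proof.
move=> u0 u00 phiE f; set e := fps_order u.
pose r (g : {fps K}) := \sum_(i < e) fpsC (coefs g i) * fpsX ^+ i.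
have stepP g : exists g', g = r g + u * g'.
  have [|g' gE] := @fps_dvd u (g - r g) u0; last by exists g'; rewrite -gE addrC subrK.
  move=> k ke; rewrite coefsB coefs_sum (bigD1 (Ordinal ke)) // big1 => [|i].
    by rewrite Monoid.mulm1 coefsCM coefsXn eqxx mulr1 subrr.
  by rewrite coefsCM coefsXn eq_sym -val_eqE => /negPf ->; rewrite mulr0.
have [s sE] := choice stepP.
(* The n-th coefficient of the i-th series is the coefficient of degree i in the n-th remainder. *)
exists (fun i => Fps (fun n => coefs (iter n s f) i)).
apply/eqP; rewrite -subr_eq0; apply/eqP/vanish_eq0 => n.
(* After n divisions the rest is a multiple of u^n, which vanishes to order n because [u] has no
   constant term. *)
have fE : f = \sum_(j < n) u ^+ j * r (iter j s f) + u ^+ n * iter n s f.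
  elim: n => [|n IHn]; first by rewrite big_ord0 add0r mul1r.
  by rewrite big_ord_recr /= -addrA exprSr -mulrA -mulrDr -sE.
rewrite {1}fE addrAC; apply: vanishD; last by rewrite mulrC; apply/vanishMr/vanishX.
have -> : \sum_(j < n) u ^+ j * r (iter j s f) =
    \sum_(i < e) (\sum_(j < n) fpsC (coefs (iter j s f) i) * u ^+ j) * fpsX ^+ i.
  under [RHS]eq_bigr do rewrite mulr_suml.
  rewrite exchange_big; apply: eq_bigr => j _; rewrite mulr_sumr.
  by apply: eq_bigr => i _; rewrite mulrA [u ^+ j * _]mulrC.
rewrite -sumrB; apply: vanish_sum => i _.
rewrite -mulrBl mulrC -opprB mulrN -mulNr; apply: vanishMr.
exact: (phiE (Fps (fun n => coefs (iter n s f) i))).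
Qed.

End FieldSeries.

(** * Powers of an ideal *)

Section IdealPowers.
Variables (A : comNzRingType) (I : set A).
Hypothesis IZ : forall c a, I a -> I (c * a).

Lemma ideal_mulD (J1 J2 : set A) a b :
  ideal_mul J1 J2 a -> ideal_mul J1 J2 b -> ideal_mul J1 J2 (a + b).
Proof.
case=> m [a1 [a2 [a1J a2J ->]]] [n [b1 [b2 [b1J b2J ->]]]].
pose glue (s : 'I_m -> A) (t : 'I_n -> A) i :=
  match fintype.split i with inl j => s j | inr j => t j end.
exists (m + n)%N, (glue a1 b1), (glue a2 b2); split.
- by move=> i; rewrite /glue; case: fintype.splitP.
- by move=> i; rewrite /glue; case: fintype.splitP.
rewrite big_split_ord /glue; congr (_ + _); apply: eq_bigr => i _.
  by rewrite -[lshift _ _]/(unsplit (inl i)) unsplitK.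
by rewrite -[rshift _ _]/(unsplit (inr i)) unsplitK.
Qed.

Lemma ideal_mul_mem (J1 J2 : set A) a b : J1 a -> J2 b -> ideal_mul J1 J2 (a * b).
Proof.
by move=> aJ bJ; exists 1%N, (fun=> a), (fun=> b); split; rewrite ?big_ord1.
Qed.

Lemma ideal_expD n a b : ideal_exp I n a -> ideal_exp I n b -> ideal_exp I n (a + b).
Proof. by case: n => [|n] //; apply: ideal_mulD. Qed.

Lemma ideal_exp0 n : ideal_exp I n 0.
Proof.
case: n => [|n] //=; exists 0%N, (fun=> 0), (fun=> 0).
by split=> [[]|[]|] //; rewrite big_ord0.
Qed.

Lemma ideal_expZ n c a : ideal_exp I n a -> ideal_exp I n (c * a).
Proof.
case: n => [|n] //= [m [a1 [a2 [a1I a2I ->]]]]; exists m, (fun i => c * a1 i), a2.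
split=> // [i|]; first exact: IZ.
by rewrite mulr_sumr; apply: eq_bigr => i _; rewrite mulrA.
Qed.

Lemma ideal_exp_sum n J (r : seq J) (P : pred J) (F : J -> A) :
  (forall i, P i -> ideal_exp I n (F i)) -> ideal_exp I n (\sum_(i <- r | P i) F i).
Proof.
move=> FI; apply: (big_ind (ideal_exp I n)) => //; first exact: ideal_exp0.
by move=> a b; apply: ideal_expD.
Qed.

Lemma ideal_exp_monomial n k a b :
  I a -> I b -> (k <= n)%N -> ideal_exp I n (a ^+ (n - k) * b ^+ k).
Proof.
move=> aI bI; elim: n k => [|n IHn] k //.
case: k => [_|k]; last by rewrite ltnS subSS exprS mulrCA => kn; apply/ideal_mul_mem/IHn.
have := IHn 0%N (leq0n n); rewrite !subn0 exprS -mulrA.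
exact: ideal_mul_mem.
Qed.

(** Orders of vanishing add up in products. This carries congruences modulo powers of the maximal
    ideal of the curve to congruences of series on a branch. *)
Lemma ideal_exp_vanish (R : comNzRingType) (phi : {rmorphism A -> {fps R}}) n a :
  (forall b, I b -> vanish 1 (phi b)) -> ideal_exp I n a -> vanish n (phi a).
Proof.
move=> Iphi; elim: n a => [|n IHn] a //= [m [a1 [a2 [a1I a2I ->]]]].
rewrite rmorph_sum; apply: vanish_sum => i _; rewrite rmorphM -add1n.
by apply: vanishM; [apply: Iphi|apply: IHn].
Qed.

End IdealPowers.

(** * Two variables: the (X,Y)-adic filtration and substitution *)

Section TwoVariables.
Variable K : fieldType.
Notation KXY := {fps {fps K}}.
Implicit Types a b : KXY.

(** The n-th power of the ideal (X,Y), read on coefficients: that of Y^k is divisible by X^(n-k).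
    The subtraction is truncated, so nothing is asked for k >= n. *)
Definition vanishXY n : set KXY := [set a | forall k, vanish (n - k) (coefs a k)].

Lemma vanishXYD n a b : vanishXY n a -> vanishXY n b -> vanishXY n (a + b).
Proof. by move=> va vb k; apply: vanishD. Qed.

Lemma vanishXYM m n a b : vanishXY m a -> vanishXY n b -> vanishXY (m + n) (a * b).
Proof.
move=> va vb k; apply: vanish_sum => i _.
apply: (@vanishW _ _ ((m - i) + (n - (k - i)))); last exact: vanishM.
by have := ltn_ord i; lia.
Qed.

Lemma vanishXYMr n a b : vanishXY n b -> vanishXY n (a * b).
Proof. by move=> vb; rewrite -[n]add0n; apply: vanishXYM => // k; rewrite sub0n. Qed.

Lemma vanishXYN n a : vanishXY n a -> vanishXY n (- a).
Proof. by rewrite -mulN1r; apply: vanishXYMr. Qed.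

Lemma vanishXY_sum n I (r : seq I) (P : pred I) (F : I -> KXY) :
  (forall i, P i -> vanishXY n (F i)) -> vanishXY n (\sum_(i <- r | P i) F i).
Proof.
by move=> vF; apply: (big_ind (vanishXY n)) => //; apply: vanishXYD.
Qed.

Lemma vanishXY_eq a b : (forall n, vanishXY n (a - b)) -> a = b.
Proof.
move=> vab; apply/eqP; rewrite -subr_eq0; apply/eqP/fpsP => k.
by apply: vanish_eq0 => n; have := vab (n + k)%N k; rewrite addnK.
Qed.

Lemma vanishXYX n a : vanishXY 1 a -> vanishXY n (a ^+ n).
Proof.
move=> va; elim: n => [|n IHn]; first by move=> k; rewrite sub0n.
by rewrite exprS -add1n; apply: vanishXYM.
Qed.

Lemma vanishXY1 a : coefs (coefs a 0) 0 = 0 -> vanishXY 1 a.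
Proof. by move=> a00 [|k] // [|l]. Qed.

Definition cstXY : {rmorphism K -> KXY} := @fpsC {fps K} \o @fpsC K.

(** Modulo (X,Y)^n, the series f(a) is the value at [a] of a truncation of f, so the morphism laws
    follow from those of polynomial evaluation by letting n vary. *)
Lemma fps_subst a : vanishXY 1 a ->
  exists ev : {rmorphism {fps K} -> KXY}, ev fpsX = a /\
    forall f n, vanishXY n (ev f - \sum_(j < n) constXY (coefs f j) * a ^+ j).
Proof.
move=> va; pose S n f := \sum_(j < n) constXY (coefs f j) * a ^+ j.
(* The coefficient of X^l Y^k only receives contributions from a^j with j <= k + l. *)
pose ev f : KXY := Fps (fun k => Fps (fun l => coefs (coefs (S (k + l).+1 f) k) l)).
have evP f n : vanishXY n (ev f - S n f).
  move=> k l; rewrite ltn_subRL => kln; apply/eqP; rewrite subr_eq0; apply/eqP.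
  elim: n kln => // n IHn; rewrite ltnS leq_eqVlt => /orP[/eqP<-//|kln].
  rewrite IHn // /S big_ord_recr /= [RHS](_ : _ = coefs (coefs (S n f) k) l +
    coefs (coefs (constXY (coefs f n) * a ^+ n) k) l) //.
  by rewrite [X in _ + X](vanishXYMr _ (vanishXYX va)) ?addr0 // ltn_subRL.
have SE n f : S n f = (map_poly cstXY (fps_trunc n f)).[a].
  rewrite (@horner_coef_wide _ n) ?size_map_poly ?size_poly //.
  by apply: eq_bigr => i _; rewrite coef_map coef_poly ltn_ord.
have horner_vanish n (p : {poly K}) : (forall i, (i < n)%N -> p`_i = 0) ->
    vanishXY n (map_poly cstXY p).[a].
  move=> p0; rewrite horner_coef; apply: vanishXY_sum => i _.
  rewrite coef_map; have [lt_in|le_ni] := ltnP i n.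
    by rewrite p0 // [X in X * _](rmorph0 cstXY) mul0r.
  by rewrite -(subnK le_ni) exprD mulrA; apply/vanishXYMr/vanishXYX.
have ev_zmod : zmod_morphism ev.
  move=> f g; apply: vanishXY_eq => n.
  have SB : S n (f - g) = S n f - S n g.
    rewrite -sumrB; apply: eq_bigr => i _; rewrite -mulrBl; congr (_ * _).
    exact: (rmorphB cstXY).
  have -> : ev (f - g) - (ev f - ev g) = (ev (f - g) - S n (f - g)) +
      - ((ev f - S n f) + - (ev g - S n g)) by rewrite SB; ring.
  by do ?[exact: evP|apply: vanishXYD|apply: vanishXYN].
have ev_monoid : monoid_morphism ev.
  split=> [|f g]; apply: vanishXY_eq => n.
    case: n => [|n]; first by move=> k; rewrite sub0n.
    rewrite -[X in _ - X](_ : S n.+1 1 = 1); first exact: evP.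
    rewrite /S big_ord_recl /= mulr1 big1 ?addr0; first exact: (rmorph1 cstXY).
    by move=> i _; rewrite [constXY _](rmorph0 cstXY) mul0r.
  (* Three truncation errors, plus the value at [a] of a polynomial without terms of degree below
     n. *)
  have -> : ev (f * g) - ev f * ev g = (ev (f * g) - S n (f * g)) +
      (- (ev g * (ev f - S n f)) +
      (- (S n f * (ev g - S n g)) + (S n (f * g) - S n f * S n g))) by ring.
  apply: vanishXYD; first exact: evP.
  apply: vanishXYD; first by apply/vanishXYN/vanishXYMr/evP.
  apply: vanishXYD; first by apply/vanishXYN/vanishXYMr/evP.
  rewrite !SE -hornerM -rmorphM -hornerN -hornerD -rmorphN -rmorphD.
  apply: horner_vanish => i lt_in; rewrite coefB coef_poly lt_in.
  by rewrite (coef_fps_mul _ _ lt_in) subrr.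
pose evM := GRing.isZmodMorphism.Build _ _ ev ev_zmod.
pose evM' := GRing.isMonoidMorphism.Build _ _ ev ev_monoid.
pose evR : {rmorphism {fps K} -> KXY} := HB.pack ev evM evM'.
exists evR; split=> //; apply: vanishXY_eq => n.
(* At least two terms are needed for the partial sum to contain the linear term. *)
have SX : S n.+2 fpsX = a.
  rewrite /S 2!big_ord_recl [constXY _](rmorph0 cstXY) mul0r add0r.
  by rewrite big1 ?addr0 => [|i _]; [apply: mul1r|rewrite mul0r].
move=> k; have := evP fpsX n.+2 k; rewrite SX; apply: vanishW.
by rewrite leq_sub2r // -addn2 leq_addr.
Qed.

Definition varX : KXY := fpsC fpsX.
Definition varY : KXY := fpsX.

(** By induction: an element of positive level has no constant term, so it splits as X b + Y c, with
    b free of Y and both b and c one level lower. *)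
Lemma vanishXY_ideal_exp (A : comNzRingType) (I : set A)
    (phi : {rmorphism KXY -> A}) n a :
  (forall r s, I s -> I (r * s)) -> I (phi varX) -> I (phi varY) ->
  vanishXY n a -> ideal_exp I n (phi a).
Proof.
move=> IZ IX IY; elim: n a => [|n IHn] a va //.
have -> : a = varX * fpsC (fps_shift (coefs a 0)) + varY * fps_shift a.
  rewrite {1}[a]fps_shiftE {1}[coefs a 0]fps_shiftE va // rmorph0 add0r.
  by rewrite rmorphM.
rewrite rmorphD !rmorphM; apply: ideal_mulD; apply: ideal_mul_mem => //.
  apply: IHn => -[|k]; last by move=> l _.
  by move=> l ln; apply: va; rewrite subn0 in ln *.
by apply: IHn => k; have := va k.+1; rewrite subSS.
Qed.

(* A morphism of K-algebras is local: [1 - a / c] is a unit of K[[X,Y]] when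
   the constant term of [a] is 0, so its image has a nonzero constant term. *)
Lemma coefs0_morphism (phi : {rmorphism KXY -> {fps K}}) a :
  (forall c, phi (constXY c) = fpsC c) ->
  coefs (phi a) 0 = coefs (coefs a 0) 0.
Proof.
move=> phiC.
have local b : coefs (coefs b 0) 0 = 0 -> coefs (phi b) 0 = 0.
  move=> b00; apply/eqP/negP => /negP c0; set c := coefs (phi b) 0 in c0.
  have : 1 - constXY c^-1 * b \is a GRing.unit.
    rewrite !fps_unitE coefsB 2!coefs0M b00 mulr0 subr0.
    exact: unitr1.
  move=> /(rmorph_unit phi).
  rewrite rmorphB rmorph1 rmorphM phiC fps_unitE coefsB coefsCM -/c mulVf //.
  by rewrite subrr unitr0.
apply/eqP; rewrite -subr_eq0 -[X in _ - X]/(coefs (fpsC (coefs (coefs a 0) 0)) 0).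
by rewrite -phiC -coefsB -rmorphB local // !coefsB subrr.
Qed.

End TwoVariables.

(** * Polynomials evaluated at y/x, and the blow-up *)

Lemma module_span_horner (R A : comNzRingType) (phi : {rmorphism R -> A}) N a :
  module_span (range phi) N (fun i => a ^+ i) =
  [set (map_poly phi p).[a] | p in [set p : {poly R} | (size p <= N)%N]].
Proof.
apply/seteqP; split=> [z [c [cR ->]]|_ [p pN <-]] /=; last first.
  exists (fun i => phi p`_i); split=> [i|]; first by exists p`_i.
  rewrite (@horner_coef_wide _ N) ?(leq_trans (size_poly _ _)) //.
  by apply: eq_bigr => i _; rewrite coef_map.
have {}cR i : exists q, phi q = c i by case: (cR i) => q _; exists q.
have [q qE] := choice cR.
exists (\sum_(i < N) (q i)%:P * 'X^i).
  apply: (leq_trans (size_sum _ _ _)); apply/bigmax_leqP => i _.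
  rewrite mul_polyC (leq_trans (size_scale_leq _ _)) // size_polyXn.
  exact: ltn_ord.
rewrite rmorph_sum horner_sum; apply: eq_bigr => i _.
by rewrite rmorphM /= map_polyC map_polyXn hornerM hornerC hornerXn -qE.
Qed.

(** For [a] = y/x this clears denominators: the left side is a form of degree n in x and y. *)
Lemma horner_homogenize (R A : comNzRingType) (phi : {rmorphism R -> A}) n
    (p : {poly R}) x a : (size p <= n.+1)%N ->
  \sum_(i < n.+1) phi p`_i * (x ^+ (n - i) * (x * a) ^+ i) =
  x ^+ n * (map_poly phi p).[a].
Proof.
move=> pn; rewrite (@horner_coef_wide _ n.+1) ?(leq_trans (size_poly _ _)) //.
rewrite mulr_sumr; apply: eq_bigr => i _; rewrite coef_map exprMn.
by rewrite [x ^+ _ * _]mulrA -exprD subnK; [ring|rewrite -ltnS].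
Qed.

(* Writing B for A[G], one has [m^n <= x^n B] for all [n], and [x^N B <= m^N]
   since B is spanned by the first [N] powers of [G]; so the colon rings
   [m^n : m^n] are contained in B, and the [N]-th is equal to it. *)
Lemma blowup_eq_span (R A L : comUnitRingType) (phi : {rmorphism R -> A})
    (iota : {rmorphism A -> L}) (T : R) (x y : A) N (g : {poly R}) :
  let G := iota y / iota x in let psi := iota \o phi in
  nonunits A = ideal_gen2 x y ->
  iota x \is a GRing.unit -> phi T = x ->
  [set: A] = module_span (range phi) N (fun i => y ^+ i) ->
  g \is monic -> size g = N.+1 -> (map_poly psi g).[G] = 0 ->
  blowup iota G /\ blowup iota = module_span (range psi) N (fun i => G ^+ i).
Proof.
move=> G psi mE xU phiT AE gM gN gG; set m := nonunits A in mE.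
have mZ c a : m a -> m (c * a).
  by rewrite mE => -[r [s ->]]; exists (c * r), (c * s); ring.
have mx : m x by rewrite mE; exists 1, 0; ring.
have my : m y by rewrite mE; exists 0, 1; ring.
have yG : iota y = iota x * G by rewrite /G mulrC divrK.
pose E : {rmorphism {poly R} -> L} := horner_eval G \o map_poly psi.
have EC r : E r%:P = iota (phi r) by rewrite /= map_polyC /horner_eval hornerC.
have EX : E 'X = G by rewrite /= map_polyX /horner_eval hornerX.
have AG a : exists p, iota a = E p.
  have [c [cR ->]] : module_span (range phi) N (fun i => y ^+ i) a by rewrite -AE.
  have {}cR i : exists q, phi q = c i by case: (cR i) => q _; exists q.
  have [q qE] := choice cR.
  (* Since [T] maps to x and y = xG, the polynomial [T%:P * 'X] takes the value y at G. *)
  exists (\sum_(i < N) (q i)%:P * (T%:P * 'X) ^+ i).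
  rewrite !rmorph_sum; apply: eq_bigr => i _.
  by rewrite !rmorphM !rmorphXn rmorphM EC EC EX phiT -yG qE.
have m_sub n a : ideal_exp m n a -> exists p, iota a = iota x ^+ n * E p.
  elim: n a => [|n IHn] a.
    by have [p aE] := AG a; exists p; rewrite mul1r.
  case=> k [b [c [bm cm ->]]].
  have {}bm i : exists p, iota (b i) = iota x * E p.
    have := bm i; rewrite mE => -[r [s ->]].
    have [p rE] := AG r; have [q sE] := AG s; exists (p + q * 'X).
    by rewrite 2!rmorphD !rmorphM rE sE EX yG; ring.
  have [p pE] := choice bm; have [q qE] := choice (fun i => IHn _ (cm i)).
  exists (\sum_i p i * q i); rewrite !rmorph_sum mulr_sumr; apply: eq_bigr => i _.
  by rewrite !rmorphM pE qE exprS; ring.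
have m_sup (p : {poly R}) : (size p <= N)%N ->
    (iota @` ideal_exp m N) (iota x ^+ N * E p).
  move=> pN; rewrite -[E p]/((map_poly psi p).[G]).
  rewrite -(horner_homogenize psi) ?(leq_trans pN) // -yG.
  exists (\sum_(i < N.+1) phi p`_i * (x ^+ (N - i) * y ^+ i)).
    apply: ideal_exp_sum => // i _; apply: ideal_expZ => //.
    by apply: ideal_exp_monomial => //; rewrite -ltnS.
  by rewrite rmorph_sum; apply: eq_bigr => i _; rewrite !rmorphM !rmorphXn.
have E_mod p : exists2 q : {poly R}, (size q <= N)%N & E p = E q.
  exists (Pdiv.CommonRing.rmodp p g).
    by rewrite -ltnS -gN Pdiv.CommonRing.ltn_rmodpN0 ?monic_neq0.
  rewrite {1}(Pdiv.RingMonic.rdivp_eq gM p) rmorphD rmorphM.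
  by rewrite [E g]gG mulr0 add0r.
rewrite module_span_horner; set B := [set _ | _ in _].
suff blowupE : blowup iota = B.
  split=> //; rewrite blowupE -EX; have [q qN ->] := E_mod 'X.
  by exists q.
apply/seteqP; split=> [z [n _ zn]|_ [p pN <-]].
  (* The colon condition is tested on x^n, an element of m^n: it puts x^n z in x^n B, and x^n is
     then cancelled. *)
  have [|a am aE] := zn (iota (x ^+ n)).
    exists (x ^+ n) => //; have := @ideal_exp_monomial _ m n 0 x x mx mx (leq0n n).
    by rewrite subn0 mulr1.
  have [p pE] := m_sub _ _ am; have [q qN qE] := E_mod p.
  exists q => //; rewrite -[LHS]/(E q) -qE; apply: (mulrI (unitrX n xU)).
  by rewrite -pE aE rmorphXn mulrC.
exists N => // _ [a am <-]; have [q ->] := m_sub _ _ am.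
have [s sN sE] := E_mod (p * q).
rewrite mulrCA -[(map_poly _ _).[_]]/(E p) -rmorphM sE.
exact: m_sup.
Qed.

Lemma fps_branch_annihilator (K : fieldType) (u a : {fps K})
    (phi : {rmorphism {fps K} -> {fps K}}) :
  u != 0 -> coefs u 0 = 0 ->
  (forall f n, vanish n (phi f - \sum_(j < n) fpsC (coefs f j) * u ^+ j)) ->
  exists g, [/\ g \is monic, size g = (fps_order u).+1 & (map_poly phi g).[a] = 0].
Proof.
move=> u0 u00 phiE.
(* Positivity makes 1 one of the generators. *)
have e0 : (0 < fps_order u)%N.
  rewrite lt0n; apply/eqP => e0; have [] := fps_orderP u0.
  by rewrite e0 u00 eqxx.
apply: (@monic_annihilator _ _ phi _ (fun i => fpsX ^+ i) (Ordinal e0)) => // f.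
exact: fps_division.
Qed.

(** * The curve and its branches *)

Section Branches.
Variables (K : fieldType) (d : nat) (H : 'I_d -> {fps {fps K}}).
Variables (O : comUnitRingType) (pi : {rmorphism {fps {fps K}} -> O}).
Variable nu : 'I_d -> {rmorphism O -> {fps K}}.
Hypothesis curve : plane_algebroid_curve H pi.
Hypothesis branch : forall i, branch_normalization (H i) (fun a => nu i (pi a)).

Lemma branch_kernel i a : nu i (pi a) = 0 <-> divides (H i) a.
Proof. by case: (branch i). Qed.

Lemma branch_constXY i c : nu i (pi (constXY c)) = fpsC c.
Proof. by case: (branch i). Qed.

(** Otherwise H_i would divide H_j and, by coprimality, be a unit. *)
Lemma branch_other_neq0 i j : i != j -> nu i (pi (H j)) != 0.
Proof.
have [_ irr cop _ _] := curve => ij; apply/eqP => /branch_kernel Hij.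
have [_ + _] := irr i; rewrite (cop _ _ ij) //.
by exists 1; rewrite mul1r.
Qed.

(** Factors are split off one at a time. Those already split off are nonzero on the j-th branch and
    K[[t_j]] is a domain, so the current quotient vanishes there and is divisible by H_j. *)
Lemma branch_prod_dvd r a : uniq r -> (forall i, nu i (pi a) = 0) ->
  divides (\prod_(i <- r) H i) a.
Proof.
move=> + a0; elim: r => [|j r IHr] /=.
  by exists a; rewrite big_nil mulr1.
case/andP=> jr /IHr[b aE]; have := a0 j; rewrite aE !rmorphM => /eqP.
rewrite mulf_eq0 => /orP[/eqP/branch_kernel[c bE]|].
  by exists c; rewrite big_cons bE mulrA.
rewrite !rmorph_prod prodf_seq_eq0 => /hasP[k kr /= /eqP k0].
have /branch_other_neq0 : j != k by apply: contraNneq jr => ->.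
by rewrite k0 eqxx.
Qed.

(** This embeds [O] in the product of the K[[t_i]], so that identities can be checked branch by
    branch. *)
Lemma branches_inj z : (forall i, nu i z = 0) -> z = 0.
Proof.
have [_ _ _ surj ker] := curve => z0; have [a aE] := surj z.
by rewrite -aE; apply/ker; apply: branch_prod_dvd; rewrite ?index_enum_uniq ?aE.
Qed.

Lemma lreg_branch x i : GRing.lreg x -> nu i x != 0.
Proof.
have [_ _ _ _ ker] := curve => xreg; apply/eqP => xi0.
(* The image of [b] vanishes on all branches but the i-th; if x vanished on that one, their product
   would be 0. *)
pose b := \prod_(j | j != i) H j.
have pib0 : pi b = 0.
  apply: xreg; rewrite mulr0; apply: branches_inj => j; rewrite rmorphM.
  have [->|ji] := eqVneq j i; first by rewrite xi0 mul0r.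
  have Hj0 : nu j (pi (H j)) = 0 by apply/branch_kernel; exists 1; rewrite mul1r.
  by rewrite /b (bigD1 j) //= !rmorphM Hj0 mul0r mulr0.
have /eqP : nu i (pi b) = 0 by rewrite pib0 rmorph0.
rewrite !rmorph_prod => /prodf_eq0[j ji].
by rewrite (negPf (branch_other_neq0 _)) // eq_sym.
Qed.

Lemma branch_lreg z : (forall i, nu i z != 0) -> GRing.lreg z.
Proof.
move=> z0 a b zab; apply/eqP; rewrite -subr_eq0; apply/eqP/branches_inj => i.
apply: (mulfI (z0 i)); rewrite mulr0 -rmorphM mulrBr zab subrr.
exact: rmorph0.
Qed.

Lemma coefs0_branch i a : coefs (nu i (pi a)) 0 = coefs (coefs a 0) 0.
Proof. exact: (coefs0_morphism (phi := nu i \o pi)) (branch_constXY i). Qed.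

Lemma nonunits_branch z i : nonunits O z -> vanish 1 (nu i z).
Proof.
have [_ _ _ surj _] := curve; have [a <-] := surj z => aN [|//] _.
rewrite coefs0_branch; apply/eqP; apply: contraNT aN => a0.
by apply: rmorph_unit; rewrite !fps_unitE unitfE.
Qed.

Lemma nonunits_lift a : nonunits O (pi a) <-> coefs (coefs a 0) 0 = 0.
Proof.
have [d0 _ _ _ _] := curve; pose i := Ordinal d0.
rewrite -(coefs0_branch i); split=> [/nonunits_branch->//|a0].
by apply/negP => /(rmorph_unit (nu i)); rewrite fps_unitE a0 unitr0.
Qed.

(** A lift of x to K[[X,Y]] has no constant term, so it can be substituted into series; [ev] is this
    substitution followed by [pi]. *)
Lemma power_series_in_range x :
  nonunits O x -> (forall c a, nonunits O a -> nonunits O (c * a)) ->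
  exists ev : {rmorphism {fps K} -> O},
    [/\ ev fpsX = x, power_series_in pi x = range ev &
        forall i f n, vanish n (nu i (ev f) -
          \sum_(j < n) fpsC (coefs f j) * nu i x ^+ j)].
Proof.
have [_ _ _ surj _] := curve; have [a <-] := surj x.
move=> /nonunits_lift a0 mZ; have [ev [evX evP]] := fps_subst (vanishXY1 a0).
have m_vanish n z i : ideal_exp (nonunits O) n z -> vanish n (nu i z).
  by apply: ideal_exp_vanish => b; apply: nonunits_branch.
have evO f n : ideal_exp (nonunits O) n
    (pi (ev f) - \sum_(j < n) pi (constXY (coefs f j)) * pi a ^+ j).
  have mX : nonunits O (pi (varX K)) by apply/nonunits_lift.
  have mY : nonunits O (pi (varY K)) by apply/nonunits_lift.
  have := vanishXY_ideal_exp mZ mX mY (evP f n).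
  by rewrite rmorphB rmorph_sum; under eq_bigr do rewrite rmorphM rmorphXn.
exists (pi \o ev); split=> [/=||i f n]; first by rewrite -evX.
- apply/seteqP; split=> [z [f fz]|_ [f _ <-]]; last by exists f => n; apply: evO.
  (* Limits are unique: the difference of two lies in all powers of the maximal ideal, hence
     vanishes to every order on every branch. *)
  exists f => //; apply/eqP; rewrite -subr_eq0; apply/eqP/branches_inj => i.
  apply: vanish_eq0 => n; apply: m_vanish.
  have -> : pi (ev f) - z =
      (pi (ev f) - \sum_(j < n) pi (constXY (coefs f j)) * pi a ^+ j) +
      -1 * (z - \sum_(j < n) pi (constXY (coefs f j)) * pi a ^+ j) by ring.
  by apply: ideal_expD; [apply: evO|apply: ideal_expZ].
have := m_vanish _ _ i (evO f n); rewrite rmorphB rmorph_sum.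
by under eq_bigr do rewrite rmorphM rmorphXn branch_constXY.
Qed.

(* [y] may be a zero divisor, so [e] is compared with the value of [y + c x],
   a non-zero-divisor for all but finitely many [c]. *)
Lemma branch_dvd_min_value x y e :
  infinite_set [set: K] ->
  (forall a b, nonunits O (a * x + b * y)) ->
  GRing.lreg x -> value nu x = e ->
  is_minimum (value_set nu `\ (fun=> 0%N)) e ->
  forall i, exists c, nu i y = nu i x * c.
Proof.
move=> Kinf mxy xreg xe [_ emin] i; have x0 j := lreg_branch j xreg.
apply: fps_dvd => // k kx; apply/eqP/negP => /negP yk.
have [c cP] : exists c, forall j, nu j (pi (constXY c) * x + 1 * y) != 0.
  apply: contra_notP Kinf => noc.
  pose root j : set K := [set c | nu j (pi (constXY c) * x + 1 * y) = 0].
  apply: (sub_finite_set (B := \bigcup_j root j)).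
    move=> c _; have /existsNP[j /negP] := (forallNP _).2 noc c.
    by rewrite negbK => /eqP cj; exists j.
  apply: bigcup_finite => // j _.
  (* Each branch excludes at most one c: two would give c x = c0 x there, with x nonzero. *)
  have [[c0 c0j]|noroot] := pselect (exists c, root j c); last first.
    apply: (sub_finite_set (B := set0)) => // c cj.
    by case: noroot; exists c.
  apply: (sub_finite_set (B := [set c0])) => [c cj|]; last exact: finite_set1.
  have : fpsC c * nu j x = fpsC c0 * nu j x.
    move: cj c0j; rewrite /root /= !rmorphD !rmorphM !branch_constXY => cj c0j.
    by apply: (addIr (nu j 1 * nu j y)); rewrite cj c0j.
  by move/(mulIf (x0 j)) => /(congr1 (fun f : {fps K} => coefs f 0)).
set w := _ + _ in cP.
(* Below the order of x the term c x contributes nothing, so [w] and y have the same k-th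
   coefficient. *)
have wk : coefs (nu i w) k != 0.
  rewrite rmorphD !rmorphM branch_constXY rmorph1 mul1r coefsD coefsCM.
  by have [_ ->] := fps_orderP (x0 i); rewrite // mulr0 add0r.
have w_order j := fps_orderP (cP j).
have : (e i <= value nu w i)%N.
  (* Minimality applies to [w]: it lies in the maximal ideal, so its value is not the zero
     vector. *)
  apply: emin; split; first by exists w => //; apply: branch_lreg.
  move=> /(congr1 (fun v => v i)); rewrite /value => w0.
  have [+ _] := w_order i; rewrite w0 nonunits_branch ?eqxx //.
  exact: mxy.
apply/negP; rewrite -ltnNge -xe /value (leq_ltn_trans _ kx) // leqNgt.
by apply/negP => /(w_order i).2 /eqP; rewrite (negPf wk).
Qed.

End Branches.

(** * The choice G = y/x and the comparison of the rings *)

Theorem proposition4p14 (K : fieldType) (d : nat)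
    (H : 'I_d -> {fps {fps K}})
    (O : comUnitRingType) (pi : {rmorphism {fps {fps K}} -> O})
    (nu : 'I_d -> {rmorphism O -> {fps K}})
    (L : comUnitRingType) (iota : {rmorphism O -> L})
    (x y : O) (e : 'I_d -> nat) (N : nat) :
  infinite_set [set: K] ->
  plane_algebroid_curve H pi ->
  (forall i, branch_normalization (H i) (fun a => nu i (pi a))) ->
  total_fraction_ring iota ->
  nonunits O = ideal_gen2 x y ->
  GRing.lreg x ->
  value nu x = e ->
  is_minimum (value_set nu `\ (fun=> 0%N)) e ->
  N = (\sum_(i < d) e i)%N ->
  [set: O] = module_span (power_series_in pi x) N (fun i => y ^+ i) ->
  semilocal (blowup iota) ->
  residue_fields_are_K (fun c => iota (pi (constXY c))) (blowup iota) ->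
  exists G : L,
    [/\ blowup iota G,
        blowup iota
          = module_span (iota @` power_series_in pi x) N (fun i => G ^+ i) &
        module_span (iota @` power_series_in pi x) N
            (fun i => iota x ^+ i * G ^+ i)
          = range iota].
Proof.
move=> Kinf curve branch [_ iota_unit _] mE xreg xe emin NE OE _ _.
have mxy a b : nonunits O (a * x + b * y) by rewrite mE; exists a, b.
have mx : nonunits O x by rewrite -[x]addr0 -[x in x + _]mul1r -(mul0r y).
have mZ c a : nonunits O a -> nonunits O (c * a).
  by rewrite mE => -[r [s ->]]; exists (c * r), (c * s); ring.
have [ev [evX PE evP]] := power_series_in_range curve branch mx mZ.
have xU := iota_unit _ xreg; pose G := iota y / iota x.
have x0 i := lreg_branch curve branch i xreg.
(* The series [c i] is y/x on the i-th branch. *)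
have [c yx] := choice (branch_dvd_min_value curve branch Kinf mxy xreg xe emin).
have branch_g i := fps_branch_annihilator (phi := nu i \o ev) (c i) (x0 i)
  (nonunits_branch curve branch i mx (ltn0Sn 0)) (evP i).
have [g gP] := choice branch_g.
pose gN := \prod_i g i.
have gN_monic : gN \is monic by apply: monic_prod => i _; case: (gP i).
have gN_size : size gN = N.+1.
  rewrite size_prod => [|i _]; last by have [/monic_neq0] := gP i.
  rewrite NE -xe; under eq_bigr => i _ do (have [_ -> _] := gP i; rewrite -addn1).
  by rewrite big_split sum1_card /= -addSn addnK.
have gNG : (map_poly (iota \o ev) gN).[G] = 0.
  (* Multiplied by x^N, the relation becomes the image of an identity in [O], which is checked on
     the branches. *)
  apply: (mulrI (unitrX N xU)); rewrite mulr0 -horner_homogenize ?gN_size //.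
  rewrite [iota x * G]mulrC divrK //.
  pose z := \sum_(i < N.+1) ev gN`_i * (x ^+ (N - i) * y ^+ i).
  have z0 : z = 0.
    apply: (branches_inj curve branch) => i.
    have -> : nu i z = nu i x ^+ N * (map_poly (nu i \o ev) gN).[c i].
      rewrite -horner_homogenize ?gN_size // -yx rmorph_sum.
      by apply: eq_bigr => j _; rewrite !rmorphM !rmorphXn.
    have [_ _ gi0] := gP i.
    by rewrite /gN (bigD1 i) //= rmorphM hornerM gi0 mul0r mulr0.
  rewrite -[RHS](rmorph0 iota) -z0 rmorph_sum.
  by apply: eq_bigr => j _; rewrite !rmorphM !rmorphXn.
have [blowupG blowupE] : blowup iota G /\ blowup iota = module_span (iota @` range ev) N (fun i => G ^+ i).
  rewrite image_comp; rewrite PE in OE.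
  exact: (blowup_eq_span mE xU evX OE gN_monic gN_size gNG).
exists G; rewrite PE; split=> //.
have xG i : iota x ^+ i * G ^+ i = iota (y ^+ i).
  by rewrite -exprMn [iota x * G]mulrC divrK // rmorphXn.
apply/seteqP; split=> [_ [b [bP ->]]|_ [z _ <-]] /=.
  have {}bP i : exists r, iota r = b i by case: (bP i) => r _; exists r.
  have [r rE] := choice bP; exists (\sum_(i < N) r i * y ^+ i) => //.
  by rewrite rmorph_sum; apply: eq_bigr => i _; rewrite rmorphM rE xG.
have [b [bP ->]] : module_span (power_series_in pi x) N (fun i => y ^+ i) z.
  by rewrite -OE.
exists (fun i => iota (b i)); split=> [i|]; first by exists (b i) => //; rewrite -PE.
by rewrite rmorph_sum; apply: eq_bigr => i _; rewrite rmorphM xG.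
Qed.
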